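(* Let $k$ be a field of characteristic $0$. (i) Let $L_A=I_d-\sum_{i=1}^gA_ix_i$ with $A_i\in M_d(k)$ be a monic linear pencil, and let $\mathcal A\subseteq M_d(k)$ be the (possibly non-unital) $k$-algebra generated by $A_1,\dots,A_g$. If $\mathcal A/\operatorname{rad}\mathcal A$ is isomorphic to the product of $s$ simple algebras, then $\mathscr Z(L_A)$ has exactly $s$ irreducible components. (ii) Every irreducible free locus equals $\mathscr Z(L)$ for some irreducible monic pencil $L$.
   Context: For a monic linear pencil $L=I_d-\sum_iA_ix_i$ of size $d$ and $X\in M_n(k)^g$ put $L(X)=I_d\otimes I_n-\sum_iA_i\otimes X_i$ (Kronecker product); the free locus of $L$ is $\mathscr Z(L)=\bigcup_n\{X\in M_n(k)^g:\det L(X)=0\}$. A free locus is a set of the form $\mathscr Z(L)$ for a monic pencil $L$ in the variables $x_1,\dots,x_g$ over $k$. A free locus is irreducible if it is nonempty and not a union of two strictly smaller free loci. The irreducible components of a free locus are the members of an irredundant decomposition of it as a finite union of irreducible free loci (equivalently, the maximal irreducible free loci contained in it). A monic pencil $L$ is minimal if it has the smallest size among all monic pencils with free locus $\mathscr Z(L)$; a minimal pencil $L_A$ is irreducible if the algebra generated by its coefficients is simple (with nonzero multiplication). $\operatorname{rad}\mathcal A$ is the largest nilpotent ideal of $\mathcal A$. *)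

(* Defs.v *)
From HB Require Import structures.
From mathcomp Require Import all_boot all_order all_algebra.
From mathcomp Require Import generic_quotient ring_quotient mxtens.
From mathcomp Require Import boolp classical_sets.

Set Implicit Arguments.
Unset Strict Implicit.
Unset Printing Implicit Defensive.

Import GRing.Theory.
Local Open Scope classical_set_scope.
Local Open Scope ring_scope.

Reserved Notation "x ** y" (at level 40, left associativity).

HB.mixin Record Lmodule_hasAssocMul (k : fieldType) V of GRing.Lmodule k V := {
  nmul : V -> V -> V;
  nmulA : associative nmul;
  nmulDl : left_distributive nmul +%R;
  nmulDr : right_distributive nmul +%R;
  nmulZl : forall (a : k) x y, nmul (a *: x) y = a *: nmul x y;
  nmulZr : forall (a : k) x y, nmul x (a *: y) = a *: nmul x y
}.

#[short(type="nalgType")]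
HB.structure Definition NonunitalAlgebra (k : fieldType) :=
  {V of Lmodule_hasAssocMul k V & GRing.Lmodule k V}.

Notation "x ** y" := (nmul x y) : ring_scope.

Section Notions.
Variables (k : fieldType) (V : nalgType k).
Implicit Types (S I J : set V) (x y : V) (a : k).

Definition is_subspace S :=
  [/\ S 0, forall x y, S x -> S y -> S (x + y) & forall a x, S x -> S (a *: x)].

Definition is_subalgebra S :=
  is_subspace S /\ forall x y, S x -> S y -> S (x ** y).

Definition is_ideal I :=
  is_subspace I /\ forall x y, I y -> I (x ** y) /\ I (y ** x).

Record subalgebra :=
  Subalgebra { subalgebra_set : set V; subalgebraP : is_subalgebra subalgebra_set }.

Record ideal := Ideal { ideal_set : set V; idealP : is_ideal ideal_set }.

(* [I ^ (m + 1) = 0] for some [m]: since there need not be a unit, a product of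
   [m + 1] elements is written as a left fold starting from its first factor. *)
Definition nilpotent_ideal (I : ideal) :=
  exists m : nat, forall x (s : seq V), ideal_set I x -> (forall y, y \in s -> ideal_set I y) ->
    size s = m -> foldl nmul x s = 0.

(* [J] is the radical of [V]. *)
Definition largest_nilpotent_ideal (J : ideal) :=
  nilpotent_ideal J /\ forall I : ideal, nilpotent_ideal I -> ideal_set I `<=` ideal_set J.

Definition simple_algebra :=
  (exists x y, x ** y <> 0) /\
  forall I : ideal, ideal_set I = [set 0] \/ ideal_set I = setT.

End Notions.

Section SubalgebraType.
Variables (k : fieldType) (V : nalgType k) (S : subalgebra V).

Definition subalgebra_pred : {pred V} := fun x => `[< subalgebra_set S x >].

Lemma subalgebra_pred_submod : submod_closed subalgebra_pred.
Proof.
have [[S0 SD SZ] _] := subalgebraP S; split; first exact/asboolP.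
move=> a x y /asboolP Sx /asboolP Sy; apply/asboolP.
by apply: SD => //; apply: SZ.
Qed.

HB.instance Definition _ := GRing.isSubmodClosed.Build k V subalgebra_pred
  subalgebra_pred_submod.

Record subalgebra_type := SubalgebraElt {
  subalgebra_val : V;
  subalgebra_valP : subalgebra_val \in subalgebra_pred
}.

HB.instance Definition _ := [isSub for subalgebra_val].
HB.instance Definition _ := [Choice of subalgebra_type by <:].
HB.instance Definition _ := [SubChoice_isSubLmodule of subalgebra_type by <:].

Lemma subalgebra_valD : {morph subalgebra_val : x y / x + y}.
Proof. exact: (raddfD (val : subalgebra_type -> V)). Qed.

Lemma subalgebra_valZ a : {morph subalgebra_val : x / a *: x}.
Proof. exact: (linearZ_LR (val : subalgebra_type -> V)). Qed.

Lemma subalgebra_mulP (x y : subalgebra_type) :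
  val x ** val y \in subalgebra_pred.
Proof.
apply/asboolP; apply: (subalgebraP S).2; apply/asboolP.
  exact: (subalgebra_valP x).
exact: (subalgebra_valP y).
Qed.

Definition subalgebra_mul (x y : subalgebra_type) : subalgebra_type :=
  SubalgebraElt (subalgebra_mulP x y).

Lemma subalgebra_mulA : associative subalgebra_mul.
Proof. by move=> x y z; apply/val_inj/nmulA. Qed.

Lemma subalgebra_mulDl : left_distributive subalgebra_mul +%R.
Proof.
move=> x y z; apply/val_inj; rewrite [RHS]subalgebra_valD -nmulDl.
by rewrite -subalgebra_valD.
Qed.

Lemma subalgebra_mulDr : right_distributive subalgebra_mul +%R.
Proof.
move=> x y z; apply/val_inj; rewrite [RHS]subalgebra_valD -nmulDr.
by rewrite -subalgebra_valD.
Qed.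

Lemma subalgebra_mulZl (a : k) x y :
  subalgebra_mul (a *: x) y = a *: subalgebra_mul x y.
Proof.
by apply/val_inj; rewrite [RHS]subalgebra_valZ -nmulZl -subalgebra_valZ.
Qed.

Lemma subalgebra_mulZr (a : k) x y :
  subalgebra_mul x (a *: y) = a *: subalgebra_mul x y.
Proof.
by apply/val_inj; rewrite [RHS]subalgebra_valZ -nmulZr -subalgebra_valZ.
Qed.

HB.instance Definition _ := Lmodule_hasAssocMul.Build k subalgebra_type
  subalgebra_mulA subalgebra_mulDl subalgebra_mulDr
  subalgebra_mulZl subalgebra_mulZr.

End SubalgebraType.

Section Generated.
Variables (k : fieldType) (V : nalgType k) (G : set V).

Lemma generated_is_subalgebra : is_subalgebra (smallest (@is_subalgebra k V) G).
Proof.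
split; first split.
- by move=> S [[[S0 _ _] _] _].
- by move=> x y Hx Hy S HS; case: (HS) => -[[_ SD _] _] _; apply: SD; [apply: Hx|apply: Hy].
- by move=> a x Hx S HS; case: (HS) => -[[_ _ SZ] _] _; apply: SZ; apply: Hx.
- by move=> x y Hx Hy S HS; case: (HS) => -[_ SM] _; apply: SM; [apply: Hx|apply: Hy].
Qed.

Definition generated : subalgebra V := Subalgebra generated_is_subalgebra.

End Generated.

Section QuotientAlgebra.
Variables (k : fieldType) (V : nalgType k) (I : ideal V).

Definition ideal_pred : {pred V} := fun x => `[< ideal_set I x >].

Lemma ideal_pred_submod : submod_closed ideal_pred.
Proof.
have [[I0 ID IZ] _] := idealP I; split; first exact/asboolP.
move=> a x y /asboolP Ix /asboolP Iy; apply/asboolP.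
by apply: ID => //; apply: IZ.
Qed.

HB.instance Definition _ := GRing.isSubmodClosed.Build k V ideal_pred
  ideal_pred_submod.

Lemma ideal_predMl x y : y \in ideal_pred -> x ** y \in ideal_pred.
Proof. by move=> /asboolP Iy; apply/asboolP; apply: ((idealP I).2 _ _ Iy).1. Qed.

Lemma ideal_predMr x y : y \in ideal_pred -> y ** x \in ideal_pred.
Proof. by move=> /asboolP Iy; apply/asboolP; apply: ((idealP I).2 _ _ Iy).2. Qed.

Definition quotient_algebra := Quotient.quot ideal_pred.

HB.instance Definition _ := GRing.Zmodule.on quotient_algebra.

Definition quotient_pi (x : V) : quotient_algebra := (\pi_(Quotient.quot ideal_pred) x)%qT.

Definition quotient_repr (q : quotient_algebra) : V := repr (q : Quotient.quot ideal_pred).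

Lemma quotient_reprK : cancel quotient_repr quotient_pi.
Proof. exact: reprK. Qed.

Lemma quotient_piE x y : (quotient_pi x = quotient_pi y) <-> (x - y \in ideal_pred).
Proof. by rewrite Quotient.idealrBE; split => /eqP. Qed.

Lemma quotient_piD x y : quotient_pi (x + y) = quotient_pi x + quotient_pi y.
Proof. exact: raddfD. Qed.

Lemma quotient_repr_pi x : quotient_repr (quotient_pi x) - x \in ideal_pred.
Proof. by apply/quotient_piE; rewrite quotient_reprK. Qed.

Definition quotient_scale (a : k) q : quotient_algebra :=
  quotient_pi (a *: quotient_repr q).

Definition quotient_mul p q : quotient_algebra :=
  quotient_pi (quotient_repr p ** quotient_repr q).

Lemma quotient_piZ a x : quotient_pi (a *: x) = quotient_scale a (quotient_pi x).
Proof.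
apply/esym/quotient_piE; rewrite -scalerBr.
by apply: rpredZ; exact: quotient_repr_pi.
Qed.

Lemma nmulBl (x y z : V) : (x - y) ** z = x ** z - y ** z.
Proof. by rewrite nmulDl -[- y]scaleN1r nmulZl scaleN1r. Qed.

Lemma nmulBr (x y z : V) : z ** (x - y) = z ** x - z ** y.
Proof. by rewrite nmulDr -[- y]scaleN1r nmulZr scaleN1r. Qed.

Lemma quotient_piM x y :
  quotient_pi (x ** y) = quotient_mul (quotient_pi x) (quotient_pi y).
Proof.
apply/esym/quotient_piE; set x' := quotient_repr _; set y' := quotient_repr _.
rewrite -(subrKA (x' ** y)) -nmulBr -nmulBl.
apply: rpredD; first by apply: ideal_predMl; apply: quotient_repr_pi.
by apply: ideal_predMr; apply: quotient_repr_pi.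
Qed.

Lemma quotient_scalerA a b q :
  quotient_scale a (quotient_scale b q) = quotient_scale (a * b) q.
Proof. by rewrite -[q]quotient_reprK -!quotient_piZ scalerA. Qed.

Lemma quotient_scale1r : left_id 1 quotient_scale.
Proof. by move=> q; rewrite -[q]quotient_reprK -!quotient_piZ scale1r. Qed.

Lemma quotient_scalerDr : right_distributive quotient_scale +%R.
Proof.
move=> a p q; rewrite -[p]quotient_reprK -[q]quotient_reprK.
by rewrite -!(quotient_piD, quotient_piZ) scalerDr.
Qed.

Lemma quotient_scalerDl q : {morph quotient_scale^~ q : a b / a + b}.
Proof.
move=> a b; rewrite -[q]quotient_reprK.
by rewrite -!quotient_piZ -quotient_piD scalerDl.
Qed.

HB.instance Definition _ := GRing.Zmodule_isLmodule.Build k quotient_algebra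
  quotient_scalerA quotient_scale1r quotient_scalerDr quotient_scalerDl.

Lemma quotient_mulA : associative quotient_mul.
Proof.
move=> p q r; rewrite -[p]quotient_reprK -[q]quotient_reprK -[r]quotient_reprK.
by rewrite -!quotient_piM nmulA.
Qed.

Lemma quotient_mulDl : left_distributive quotient_mul +%R.
Proof.
move=> p q r; rewrite -[p]quotient_reprK -[q]quotient_reprK -[r]quotient_reprK.
by rewrite -!(quotient_piD, quotient_piM) nmulDl.
Qed.

Lemma quotient_mulDr : right_distributive quotient_mul +%R.
Proof.
move=> p q r; rewrite -[p]quotient_reprK -[q]quotient_reprK -[r]quotient_reprK.
by rewrite -!(quotient_piD, quotient_piM) nmulDr.
Qed.

Lemma quotient_mulZl (a : k) (p q : quotient_algebra) :
  quotient_mul (a *: p) q = a *: quotient_mul p q.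
Proof.
rewrite -[p]quotient_reprK -[q]quotient_reprK -[LHS]/(quotient_mul (quotient_scale _ _) _).
by rewrite -quotient_piZ -!quotient_piM nmulZl quotient_piZ.
Qed.

Lemma quotient_mulZr (a : k) (p q : quotient_algebra) :
  quotient_mul p (a *: q) = a *: quotient_mul p q.
Proof.
rewrite -[p]quotient_reprK -[q]quotient_reprK -[LHS]/(quotient_mul _ (quotient_scale _ _)).
by rewrite -quotient_piZ -!quotient_piM nmulZr quotient_piZ.
Qed.

HB.instance Definition _ := Lmodule_hasAssocMul.Build k quotient_algebra
  quotient_mulA quotient_mulDl quotient_mulDr quotient_mulZl quotient_mulZr.

End QuotientAlgebra.

Section ProductAlgebra.
Variables (k : fieldType) (T : finType) (B : T -> nalgType k).

Definition product_algebra := {dffun forall i, B i}.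

HB.instance Definition _ := Choice.on product_algebra.

Implicit Types f g h : product_algebra.

Definition product_zero : product_algebra := [ffun i => 0 : B i].
Definition product_opp f : product_algebra := [ffun i => - f i].
Definition product_add f g : product_algebra := [ffun i => f i + g i].
Definition product_scale (a : k) f : product_algebra := [ffun i => a *: f i].
Definition product_mul f g : product_algebra := [ffun i => f i ** g i].

Lemma product_addA : associative product_add.
Proof. by move=> f g h; apply/ffunP => i; rewrite !ffunE addrA. Qed.
Lemma product_addC : commutative product_add.
Proof. by move=> f g; apply/ffunP => i; rewrite !ffunE addrC. Qed.
Lemma product_add0 : left_id product_zero product_add.
Proof. by move=> f; apply/ffunP => i; rewrite !ffunE add0r. Qed.
Lemma product_addN : left_inverse product_zero product_opp product_add.
Proof. by move=> f; apply/ffunP => i; rewrite !ffunE addNr. Qed.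

HB.instance Definition _ := GRing.isZmodule.Build product_algebra
  product_addA product_addC product_add0 product_addN.

Lemma product_scalerA a b f :
  product_scale a (product_scale b f) = product_scale (a * b) f.
Proof. by apply/ffunP => i; rewrite !ffunE scalerA. Qed.
Lemma product_scale1r : left_id 1 product_scale.
Proof. by move=> f; apply/ffunP => i; rewrite !ffunE scale1r. Qed.
Lemma product_scalerDr : right_distributive product_scale +%R.
Proof. by move=> a f g; apply/ffunP => i; rewrite !ffunE scalerDr. Qed.
Lemma product_scalerDl f : {morph product_scale^~ f : a b / a + b}.
Proof. by move=> a b; apply/ffunP => i; rewrite !ffunE scalerDl. Qed.

HB.instance Definition _ := GRing.Zmodule_isLmodule.Build k product_algebra
  product_scalerA product_scale1r product_scalerDr product_scalerDl.

Lemma product_mulA : associative product_mul.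
Proof. by move=> f g h; apply/ffunP => i; rewrite !ffunE nmulA. Qed.
Lemma product_mulDl : left_distributive product_mul +%R.
Proof. by move=> f g h; apply/ffunP => i; rewrite !ffunE nmulDl. Qed.
Lemma product_mulDr : right_distributive product_mul +%R.
Proof. by move=> f g h; apply/ffunP => i; rewrite !ffunE nmulDr. Qed.
Lemma product_mulZl (a : k) f g : product_mul (a *: f) g = a *: product_mul f g.
Proof. by apply/ffunP => i; rewrite !ffunE nmulZl. Qed.
Lemma product_mulZr (a : k) f g : product_mul f (a *: g) = a *: product_mul f g.
Proof. by apply/ffunP => i; rewrite !ffunE nmulZr. Qed.

HB.instance Definition _ := Lmodule_hasAssocMul.Build k product_algebra
  product_mulA product_mulDl product_mulDr product_mulZl product_mulZr.

End ProductAlgebra.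

Definition isomorphic (k : fieldType) (V W : nalgType k) :=
  exists f : {linear V -> W}, bijective f /\ {morph f : x y / x ** y}.

Definition product_of_simples (k : fieldType) (V : nalgType k) (s : nat) :=
  exists B : 'I_s -> nalgType k,
    (forall i, simple_algebra (B i)) /\ isomorphic V (product_algebra B).

HB.instance Definition _ (k : fieldType) (d : nat) :=
  Lmodule_hasAssocMul.Build k 'M[k]_d (@mulmxA _ _ _ _ _)
    (fun A B C => mulmxDl A B C) (fun A B C => mulmxDr A B C)
    (fun a A B => esym (scalemxAl a A B)) (fun a A B => esym (scalemxAr a A B)).

(* The pencil [I_d - \sum_i A_i x_i] is given by its size [d] and its
   coefficients [A_i].  Size [0] is harmless: such a pencil has the same (empty)
   free locus as the pencil of size [1] with zero coefficients. *)
Record monic_pencil (k : fieldType) (g : nat) := MonicPencil {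
  psize : nat;
  pcoef : 'I_g -> 'M[k]_psize
}.

Definition matrix_tuple (k : fieldType) (g : nat) := {n : nat & 'I_g -> 'M[k]_n}.

Section FreeLoci.
Variables (k : fieldType) (g : nat).
Implicit Types (L : monic_pencil k g) (Z : set (matrix_tuple k g)).

Definition pencil_eval L n (X : 'I_g -> 'M[k]_n) : 'M[k]_(psize L * n) :=
  1%:M *t 1%:M - \sum_(i < g) pcoef L i *t X i.

(* No point of size [n = 0] lies in the locus, an empty determinant being [1]. *)
Definition free_locus L : set (matrix_tuple k g) :=
  [set X | \det (pencil_eval L (projT2 X)) = 0].

Definition is_free_locus Z := exists L, Z = free_locus L.

Definition irreducible_locus Z :=
  [/\ is_free_locus Z, Z !=set0 &
      ~ exists Z1 Z2, [/\ is_free_locus Z1, is_free_locus Z2,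
          Z1 `<` Z, Z2 `<` Z & Z = Z1 `|` Z2]].

Definition irredundant_decomposition Z (t : nat)
    (C : 'I_t -> set (matrix_tuple k g)) :=
  [/\ forall i, irreducible_locus (C i), Z = \bigcup_i C i &
      forall i, Z <> \bigcup_(j in [set j | j != i]) C j].

(* The members of an irredundant decomposition are pairwise distinct.  That they
   depend only on [Z] is part of the assertion. *)
Definition has_exactly_components Z (s : nat) :=
  exists C : 'I_s -> set (matrix_tuple k g),
    irredundant_decomposition Z C /\
    forall t (D : 'I_t -> set (matrix_tuple k g)),
      irredundant_decomposition Z D -> range D = range C.

Definition coefficient_algebra L : nalgType k :=
  subalgebra_type (generated (range (pcoef L))).

Definition minimal_pencil L :=
  forall L', free_locus L' = free_locus L -> (psize L <= psize L')%N.

Definition irreducible_pencil L :=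
  minimal_pencil L /\ simple_algebra (coefficient_algebra L).

End FreeLoci.

(* Main.v *)
Require Import Defs.
From mathcomp Require Import all_boot all_order all_algebra.
From mathcomp Require Import mxtens boolp classical_sets.

(* Let [ann L] be the set of noncommutative polynomials without constant term
   that vanish on the coefficients of [L].  For [L] with simple coefficient
   module and any [W], [Z(L)] is contained in [Z(W)] if and only if [ann W] is
   contained in [ann L].
   - If [X] is outside [Z(W)], then [N = \sum_i W_i *t X_i] does not have the
     eigenvalue [1], so [q(N) = 0] for some [q] with [q(0) = 0] and [q(1) = 1].
     The entries of [q(\sum_i x_i *t X_i)] lie in [ann W]; when they vanish
     on [L] too, [\sum_i L_i *t X_i] does not have the eigenvalue [1] either.
   - A nonzero ideal of an algebra acting irreducibly contains the identity, so
     if [ann W] is not contained in [ann L], some [t] is [1] on [L] and [0] on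
     [W].  By linearization there is a point [X] such that, for every [A],
     [\det L_A(X) = 0] if and only if [1] is an eigenvalue of [t(A)]; it lies
     in [Z(L)] but not in [Z(W)].
   Hence the loci of simple pencils are irreducible.  A pencil of least size
   with a given irreducible locus is simple, for otherwise a submodule and its
   quotient would decompose the locus.  For each simple factor of the algebra
   modulo its radical, a pencil [V] of least size whose annihilator is contained
   in the kernel of the projection to that factor is simple, with [ann V] equal
   to this kernel; the loci of these pencils are the components. *)

Set Implicit Arguments.
Unset Strict Implicit.
Unset Printing Implicit Defensive.

Import GRing.Theory.
Local Open Scope ring_scope.

(** * Noncommutative polynomials and their values *)

Lemma big_option (V : nmodType) (T : finType) (F : option T -> V) :
  \sum_x F x = F None + \sum_x F (Some x).
Proof.
rewrite (bigD1 None) //=; congr (_ + _).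
rewrite (@reindex_omap _ _ _ _ _ Some id); last by case.
by apply: eq_bigl => x; rewrite eqxx.
Qed.

(* Noncommutative polynomials in [g] variables without constant term. *)
Inductive term (k : Type) (g : nat) : Type :=
| Var of 'I_g
| Zero
| Add of term k g & term k g
| Mul of term k g & term k g
| Scale of k & term k g.
Arguments Var {k g}.
Arguments Zero {k g}.

Fixpoint teval (k : fieldType) (g : nat) (V : nalgType k) (a : 'I_g -> V)
    (t : term k g) : V :=
  match t with
  | Var i => a i
  | Zero => 0
  | Add t1 t2 => teval a t1 + teval a t2
  | Mul t1 t2 => teval a t1 ** teval a t2
  | Scale c t1 => c *: teval a t1
  end.

Definition mxeval (k : fieldType) (g d : nat) (A : 'I_g -> 'M[k]_d) t : 'M[k]_d :=
  teval A t.

Lemma mxevalD (k : fieldType) (g d : nat) (A : 'I_g -> 'M[k]_d) t u :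
  mxeval A (Add t u) = mxeval A t + mxeval A u.
Proof. by []. Qed.

Lemma mxevalM (k : fieldType) (g d : nat) (A : 'I_g -> 'M[k]_d) t u :
  mxeval A (Mul t u) = mxeval A t *m mxeval A u.
Proof. by []. Qed.

Lemma mxevalZ (k : fieldType) (g d : nat) (A : 'I_g -> 'M[k]_d) a t :
  mxeval A (Scale a t) = a *: mxeval A t.
Proof. by []. Qed.

(** * Points of a free locus as fixed families of row vectors *)

Section FixedFamilies.
Variables (k : fieldType) (g : nat).

(** Right multiplication by [\sum_i A i *t X i], a row vector of length [d * n] being read as [n]
    row vectors of length [d]. An arbitrary finite index type lets systems be glued along sums and
    options. *)
Definition pencil_act d (A : 'I_g -> 'M[k]_d) (T : finType)
    (X : 'I_g -> T -> T -> k) (y : T -> 'rV[k]_d) (c : T) : 'rV[k]_d :=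
  \sum_i \sum_r X i r c *: (y r *m A i).

Definition encode_family d n (y : 'I_n -> 'rV[k]_d) : 'rV[k]_(d * n) :=
  \row_j y (mxtens_unindex j).2 0 (mxtens_unindex j).1.

Lemma encode_family_surj d n (v : 'rV[k]_(d * n)) :
  v = encode_family (fun r => \row_j v 0 (mxtens_index (j, r))).
Proof. by apply/rowP => j; rewrite !mxE -surjective_pairing mxtens_unindexK. Qed.

Lemma encode_family_inj d n (y z : 'I_n -> 'rV[k]_d) :
  encode_family y = encode_family z -> y =1 z.
Proof.
move=> /rowP e r; apply/rowP => j; have := e (mxtens_index (j, r)).
by rewrite !mxE mxtens_indexK.
Qed.

Lemma encode_pencil_act d n (A : 'I_g -> 'M[k]_d) (X : 'I_g -> 'M[k]_n) y :
  encode_family y *m (\sum_i A i *t X i)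
  = encode_family (pencil_act A (fun i => X i) y).
Proof.
apply/rowP => l; case: (mxtens_indexP l) => l0 l1.
rewrite mulmx_sumr summxE mxE mxtens_indexK summxE.
apply: eq_bigr => i _; rewrite mxE summxE.
rewrite (reindex (@mxtens_index d n)); last first.
  by exists (@mxtens_unindex d n) => ? _; rewrite ?mxtens_indexK ?mxtens_unindexK.
pose F a b := y b 0 a * (A i a l0 * X i b l1).
rewrite (eq_bigr (fun p : 'I_d * 'I_n => F p.1 p.2)).
  rewrite -(pair_bigA _ F) /= exchange_big /= /F.
  apply: eq_bigr => r _; rewrite !mxE mulr_sumr; apply: eq_bigr => a _.
  by rewrite [A i a l0 * _]mulrC mulrCA.
by case=> a b _; rewrite tensmxE mxE mxtens_indexK.
Qed.

Lemma tensmx1 d n : 1%:M *t 1%:M = 1%:M :> 'M[k]_(d * n).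
Proof.
apply/matrixP => i j; case: (mxtens_indexP i) => i0 i1.
case: (mxtens_indexP j) => j0 j1; rewrite tensmxE !mxE -natrM mulnb.
by rewrite (can_eq (@mxtens_indexK d n)) xpair_eqE.
Qed.

Lemma free_locusP (L : monic_pencil k g) n (X : 'I_g -> 'M[k]_n) :
  free_locus L (existT _ n X) <->
  exists y : 'I_n -> 'rV[k]_(psize L),
    (exists c, y c != 0) /\
    forall c, y c = pencil_act (pcoef L) (fun i => X i) y c.
Proof.
have fixE v : (v *m pencil_eval L X = 0) <-> (v = v *m (\sum_i pcoef L i *t X i)).
  rewrite /pencil_eval tensmx1 mulmxBr mulmx1.
  by split => [/eqP|{1}->]; rewrite ?subrr // subr_eq0 => /eqP.
split=> [/eqP/det0P[v vn0 /fixE]|[y [[c yc0] yfix]]].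
  rewrite [LHS]encode_family_surj [X in X *m _]encode_family_surj.
  rewrite encode_pencil_act => /encode_family_inj vfix.
  exists (fun r => \row_j v 0 (mxtens_index (j, r))); split=> //.
  apply/existsP; apply: contraNT vn0 => /existsPn v0.
  apply/eqP/rowP => j; case: (mxtens_indexP j) => a r.
  by have /negPn/eqP/rowP/(_ a) := v0 r; rewrite !mxE.
apply/eqP/det0P; exists (encode_family y).
  apply: contra yc0 => /eqP y0; apply/eqP.
  apply: (@encode_family_inj _ _ y (fun=> 0)); rewrite y0.
  by apply/rowP => j; rewrite !mxE.
apply/fixE; rewrite encode_pencil_act; congr encode_family.
exact/funext.
Qed.

End FixedFamilies.

(** * Linearization of noncommutative polynomials *)

Section Linearization.
Variables (k : fieldType) (g : nat).

(* In the linear system [C], the index [Some a] is an auxiliary unknown, while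
   [None] is the input as a row index and the output as a column index: the
   unknowns are determined by the input [u], and the output is [u *m t]. *)
Definition linearizable (t : term k g) :=
  exists (T : finType) (C : 'I_g -> option T -> option T -> k) (s : T -> term k g),
  forall d (A : 'I_g -> 'M[k]_d) (y : option T -> 'rV[k]_d),
    let solved := forall a, y (Some a) = y None *m mxeval A (s a) in
    ((forall a, y (Some a) = pencil_act A C y (Some a)) <-> solved) /\
    (solved -> pencil_act A C y None = y None *m mxeval A t).

(** Here [j] embeds a small system into a large one and [p] is its partial inverse. A column
    supported on the image of [j] sees only the small system. *)
Lemma pencil_act_glue d (A : 'I_g -> 'M[k]_d) (T T' : finType)
    (C : 'I_g -> T -> T -> k) (C' : 'I_g -> T' -> T' -> k) y y' c c'
    (p : T' -> option T) (j : T -> T') :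
  (forall r r', p r' = Some r <-> r' = j r) ->
  (forall i r', C' i r' c' = oapp (fun r => C i r c) 0 (p r')) ->
  (forall r, y r = y' (j r)) ->
  pencil_act A C' y' c' = pencil_act A C y c.
Proof.
move=> pj CC' yy'; apply: eq_bigr => i _.
rewrite (bigID (fun r' => isSome (p r'))) /= addrC big1 ?add0r; last first.
  by move=> r' pr'; rewrite CC'; case: (p r') pr' => //= _; rewrite scale0r.
rewrite (reindex_omap j p); last first.
  by move=> r'; case E: (p r') => [r|] //= _; rewrite (pj r r').1.
apply: eq_big => [r|r _]; have pr : p (j r) = Some r by apply/pj.
  by rewrite pr eqxx.
by rewrite CC' pr yy'.
Qed.

Lemma pencil_actD d (A : 'I_g -> 'M[k]_d) (T : finType)
    (C C1 C2 : 'I_g -> T -> T -> k) y c :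
  (forall i r, C i r c = C1 i r c + C2 i r c) ->
  pencil_act A C y c = pencil_act A C1 y c + pencil_act A C2 y c.
Proof.
move=> CE; rewrite -big_split; apply: eq_bigr => i _ /=.
by rewrite -big_split; apply: eq_bigr => r _; rewrite CE scalerDl.
Qed.

Lemma linearizable_Var i : linearizable (Var i).
Proof.
exists void, (fun j _ _ => (j == i)%:R), (fun=> Zero) => d A y /=.
split; first by split=> _; case.
move=> _; rewrite /pencil_act (bigD1 i) //= [X in _ + X]big1 ?addr0.
  by rewrite big_option eqxx scale1r [X in _ + X]big1 ?addr0 // => -[].
by move=> j /negPf ji; rewrite big1 // => r _; rewrite ji scale0r.
Qed.

Lemma linearizable_Zero : linearizable Zero.
Proof.
exists void, (fun _ _ _ => 0), (fun=> Zero) => d A y /=.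
split; first by split=> _; case.
move=> _; rewrite /pencil_act mulmx0 big1 // => i _.
by rewrite big1 // => r _; rewrite scale0r.
Qed.

Lemma linearizable_Scale a t : linearizable t -> linearizable (Scale a t).
Proof.
move=> [T [C [s H]]].
exists T, (fun i r c => if c is None then a * C i r c else C i r c), s => d A y /=.
have [H1 H2] := H d A y; split=> [//|/H2]; rewrite /mxeval /= -scalemxAr => <-.
rewrite /pencil_act scaler_sumr; apply: eq_bigr => i _.
by rewrite scaler_sumr; apply: eq_bigr => r _; rewrite scalerA.
Qed.

(** The two systems run side by side on the same input, with disjoint auxiliary unknowns, and their
    output columns are added. *)
Lemma linearizable_Add t1 t2 :
  linearizable t1 -> linearizable t2 -> linearizable (Add t1 t2).
Proof.
move=> [T1 [C1 [s1 H1]]] [T2 [C2 [s2 H2]]].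
pose p1 (r : option (T1 + T2)) : option (option T1) :=
  match r with None => Some None | Some (inl b) => Some (Some b) | _ => None end.
pose p2 (r : option (T1 + T2)) : option (option T2) :=
  match r with None => Some None | Some (inr b) => Some (Some b) | _ => None end.
pose j1 := omap (@inl T1 T2); pose j2 := omap (@inr T1 T2).
have pj1 r r' : p1 r' = Some r <-> r' = j1 r.
  by case: r' r => [[b|b]|] [r|] //=; split=> // -[->].
have pj2 r r' : p2 r' = Some r <-> r' = j2 r.
  by case: r' r => [[b|b]|] [r|] //=; split=> // -[->].
pose D1 i r (c : option (T1 + T2)) :=
  oapp (fun r1 => C1 i r1 (if c is Some (inl a) then Some a else None)) 0 (p1 r).
pose D2 i r (c : option (T1 + T2)) :=
  oapp (fun r1 => C2 i r1 (if c is Some (inr a) then Some a else None)) 0 (p2 r).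
pose C i r c := match c with
  | None => D1 i r c + D2 i r c
  | Some (inl _) => D1 i r c | Some (inr _) => D2 i r c end.
exists (T1 + T2)%type, C, (fun a => match a with inl a => s1 a | inr a => s2 a end).
move=> d A y /=.
have [E1 F1] := H1 d A (y \o j1); have [E2 F2] := H2 d A (y \o j2).
have a1 a : pencil_act A C y (Some (inl a)) = pencil_act A C1 (y \o j1) (Some a).
  exact: (@pencil_act_glue _ _ _ _ _ _ _ _ _ _ p1 j1).
have a2 a : pencil_act A C y (Some (inr a)) = pencil_act A C2 (y \o j2) (Some a).
  exact: (@pencil_act_glue _ _ _ _ _ _ _ _ _ _ p2 j2).
split; last first.
  move=> S; rewrite (@pencil_actD _ _ _ _ D1 D2) //.
  rewrite (@pencil_act_glue _ _ _ _ C1 _ (y \o j1) _ None _ p1 j1) // F1; last first.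
    by move=> a; apply: S.
  rewrite (@pencil_act_glue _ _ _ _ C2 _ (y \o j2) _ None _ p2 j2) // F2; last first.
    by move=> a; apply: S.
  by rewrite -mulmxDr.
split=> [S [a|a]|S].
- by apply: E1.1 => b /=; rewrite -a1 S.
- by apply: E2.1 => b /=; rewrite -a2 S.
have S1 := E1.2 (fun a => S (inl a)); have S2 := E2.2 (fun a => S (inr a)).
by case=> a; [rewrite a1 -S1|rewrite a2 -S2].
Qed.

(** The systems run in series: the output of the first is stored in a new unknown, [Some None],
    which is the input of the second. *)
Lemma linearizable_Mul t1 t2 :
  linearizable t1 -> linearizable t2 -> linearizable (Mul t1 t2).
Proof.
move=> [T1 [C1 [s1 H1]]] [T2 [C2 [s2 H2]]].
pose T := option (T1 + T2).
pose p1 (r : option T) : option (option T1) :=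
  match r with None => Some None | Some (Some (inl b)) => Some (Some b) | _ => None end.
pose p2 (r : option T) : option (option T2) :=
  match r with Some None => Some None | Some (Some (inr b)) => Some (Some b) | _ => None end.
pose j1 (r : option T1) : option T := omap (fun b => Some (inl b)) r.
pose j2 (r : option T2) : option T := Some (omap inr r).
have pj1 r r' : p1 r' = Some r <-> r' = j1 r.
  by case: r' r => [[[b|b]|]|] [r|] //=; split=> // -[->].
have pj2 r r' : p2 r' = Some r <-> r' = j2 r.
  by case: r' r => [[[b|b]|]|] [r|] //=; split=> // -[->].
pose C i r (c : option T) := match c with
  | Some (Some (inl a)) => oapp (fun r1 => C1 i r1 (Some a)) 0 (p1 r)
  | Some None => oapp (fun r1 => C1 i r1 None) 0 (p1 r)
  | Some (Some (inr a)) => oapp (fun r1 => C2 i r1 (Some a)) 0 (p2 r)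
  | None => oapp (fun r1 => C2 i r1 None) 0 (p2 r) end.
exists T, C, (fun a => match a with None => t1 | Some (inl a) => s1 a
                       | Some (inr a) => Mul t1 (s2 a) end).
move=> d A y /=.
have [E1 F1] := H1 d A (y \o j1); have [E2 F2] := H2 d A (y \o j2).
have a1 a : pencil_act A C y (Some (Some (inl a))) = pencil_act A C1 (y \o j1) (Some a).
  exact: (@pencil_act_glue _ _ _ _ _ _ _ _ _ _ p1 j1).
have a2 a : pencil_act A C y (Some (Some (inr a))) = pencil_act A C2 (y \o j2) (Some a).
  exact: (@pencil_act_glue _ _ _ _ _ _ _ _ _ _ p2 j2).
have a3 : pencil_act A C y (Some None) = pencil_act A C1 (y \o j1) None.
  exact: (@pencil_act_glue _ _ _ _ _ _ _ _ _ _ p1 j1).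
have a4 : pencil_act A C y None = pencil_act A C2 (y \o j2) None.
  exact: (@pencil_act_glue _ _ _ _ _ _ _ _ _ _ p2 j2).
split; last first.
  move=> S; rewrite a4 F2 /= ?S; first by rewrite -mulmxA.
  by move=> a /=; rewrite !S -mulmxA.
split=> S.
  have S1 := E1.1 (fun a => etrans (S (Some (inl a))) (a1 a)).
  have S2 := E2.1 (fun a => etrans (S (Some (inr a))) (a2 a)).
  have z : y (Some None) = y None *m mxeval A t1 by rewrite S a3 F1.
  by case=> [[a|a]|//]; [exact: S1|rewrite [LHS]S2 /= z -mulmxA].
have z := S None; have S1 := E1.2 (fun a => S (Some (inl a))).
have S2 : forall a, (y \o j2) (Some a) = pencil_act A C2 (y \o j2) (Some a).
  by apply/E2 => a /=; rewrite S z -mulmxA.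
case=> [[a|a]|]; [by rewrite a1 -S1|by rewrite a2 -S2|].
by rewrite a3 F1 // => a; apply: (S (Some (inl a))).
Qed.

Lemma linearization t : linearizable t.
Proof.
elim: t => [i||t1 H1 t2 H2|t1 H1 t2 H2|a t H].
- exact: linearizable_Var.
- exact: linearizable_Zero.
- exact: linearizable_Add.
- exact: linearizable_Mul.
- exact: linearizable_Scale.
Qed.

(** Feeding the output of the linear system back into its input turns its fixed families into the
    vectors fixed by [t], each extended by its auxiliary unknowns. The system does not depend on the
    pencil. *)
Lemma term_point (t : term k g) : exists Z : matrix_tuple k g,
  forall L, free_locus L Z <->
    exists2 u : 'rV_(psize L), u != 0 & u = u *m mxeval (pcoef L) t.
Proof.
have [T [C [s H]]] := linearization t.
pose ev (c : 'I_#|{: option T}|) : option T := enum_val c.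
have evK : cancel ev enum_rank by exact: enum_valK.
have ekK : cancel enum_rank ev by exact: enum_rankK.
exists (existT (fun n => 'I_g -> 'M[k]_n) #|{: option T}|
  (fun i => \matrix_(r, c) C i (ev r) (ev c))) => L.
have actE (y : option T -> 'rV[k]_(psize L)) c :
  pencil_act (pcoef L) (fun i => \matrix_(r, c) C i (ev r) (ev c))
    (y \o ev) c = pencil_act (pcoef L) C y (ev c).
  apply: eq_bigr => i _; rewrite [RHS](reindex ev) /=; last by exists enum_rank => ? _.
  by apply: eq_bigr => r _; rewrite !mxE.
apply: (iff_trans (free_locusP _ _)); split=> [[y [[c yc0] yfix]]|[u u0 ufix]].
  pose z := y \o enum_rank.
  have yz : y = z \o ev by apply/funext => i; rewrite /z /= evK.
  have zfix c' : z c' = pencil_act (pcoef L) C z c'.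
    by rewrite -[in RHS](ekK c') -actE -yz -yfix.
  have [/iffLR/(_ (fun a => zfix (Some a))) S /(_ S) zN] := H _ (pcoef L) z.
  exists (z None); last by rewrite -zN -zfix.
  apply: contra yc0 => /eqP z0; rewrite yz /=.
  by case: (ev c) => [a|]; rewrite ?S z0 ?mul0mx.
pose z (c : option T) := if c is Some a then u *m mxeval (pcoef L) (s a) else u.
have [/iffRL E F] := H _ (pcoef L) z.
have zfix c' : z c' = pencil_act (pcoef L) C z c'.
  by case: c' => [a|]; [apply: E|rewrite F].
exists (z \o ev); split.
  by exists (enum_rank None); rewrite /= ekK.
by move=> c; rewrite actE -zfix.
Qed.

End Linearization.

(** * Points outside a free locus *)

Section RegularPoints.
Variables (k : fieldType) (g : nat).

Lemma mul_rV_eq0 d (M : 'M[k]_d) : (forall v : 'rV_d, v *m M = 0) -> M = 0.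
Proof. by move=> M0; apply/row_matrixP => i; rewrite rowE M0 row0. Qed.

(** The characteristic polynomial does not vanish at 1, since 1 is not an eigenvalue. Iterates
    instead of powers match the recursion of [pow] in [notin_regular_ann]. *)
Lemma Cayley_Hamilton_iter m (N : 'M[k]_m) :
  (forall v : 'rV_m, v *m N = v -> v = 0) ->
  exists p : {poly k}, p.[1] != 0 /\
    forall v : 'rV_m, \sum_(j < size p) p`_j *: iter j (mulmx^~ N) v = 0.
Proof.
case: m N => [|m] N N1.
  by exists 1; split=> [|v]; rewrite ?hornerC ?oner_eq0 // thinmx0.
exists (char_poly N); split=> [|v].
  rewrite -[_ == 0]/(root _ _) -eigenvalue_root_char.
  by apply/eigenvalueP => -[v]; rewrite scale1r => /N1 ->; rewrite eqxx.
have iterE j : iter j (mulmx^~ N) v = v *m (N ^+ j).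
  by elim: j => [|j /= ->]; rewrite ?mulmx1 // exprSr mulmxA.
under eq_bigr do rewrite iterE scalemxAr.
rewrite -mulmx_sumr -[RHS](mulmx0 _ v); congr (_ *m _).
transitivity (horner_mx N (char_poly N)); last exact: Cayley_Hamilton.
rewrite -[in RHS](coefK (char_poly N)) poly_def rmorph_sum; apply: eq_bigr => j _.
by rewrite /= horner_mxZ rmorphXn /= horner_mx_X.
Qed.

Definition term_sum (I : finType) (F : I -> term k g) : term k g :=
  \big[@Add k g/Zero]_i F i.

Lemma mxeval_sum d (A : 'I_g -> 'M[k]_d) (I : finType) (F : I -> term k g) :
  mxeval A (term_sum F) = \sum_i mxeval A (F i).
Proof. exact: (big_morph (mxeval A)). Qed.

Definition term_act d (A : 'I_g -> 'M[k]_d) n (t : 'I_n -> 'I_n -> term k g)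
    (y : 'I_n -> 'rV[k]_d) (c : 'I_n) : 'rV[k]_d :=
  \sum_r y r *m mxeval A (t r c).

Lemma eq_term_act d (A : 'I_g -> 'M[k]_d) n (t : 'I_n -> 'I_n -> term k g) y z :
  y =1 z -> term_act A t y =1 term_act A t z.
Proof. by move=> yz c; apply: eq_bigr => r _; rewrite yz. Qed.

Definition term_mul n (t u : 'I_n -> 'I_n -> term k g) r c :=
  term_sum (fun b => Mul (t r b) (u b c)).

Lemma term_act_mul d (A : 'I_g -> 'M[k]_d) n (t u : 'I_n -> 'I_n -> term k g) y :
  term_act A (term_mul t u) y =1 term_act A u (term_act A t y).
Proof.
move=> c; rewrite /term_act.
under eq_bigr do rewrite mxeval_sum mulmx_sumr.
rewrite exchange_big /=; apply: eq_bigr => b _.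
by rewrite mulmx_suml; apply: eq_bigr => r _; rewrite -mulmxA.
Qed.

(* Such an [X] is no point of [free_locus L] as soon as [S] vanishes on [L]: it
   has no nonzero fixed family. *)
Definition regular (S : term k g -> Prop) n (X : 'I_g -> 'M[k]_n) :=
  exists t : 'I_n -> 'I_n -> term k g, (forall r c, S (t r c)) /\
    forall d (A : 'I_g -> 'M[k]_d) (y : 'I_n -> 'rV[k]_d),
      y =1 pencil_act A (fun i => X i) y -> y =1 term_act A t y.

Definition linear_term n (X : 'I_g -> 'M[k]_n) r c : term k g :=
  term_sum (fun i => Scale (X i r c) (Var i)).

Lemma linear_term_act n (X : 'I_g -> 'M[k]_n) d (A : 'I_g -> 'M[k]_d) y :
  term_act A (linear_term X) y =1 pencil_act A (fun i => X i) y.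
Proof.
move=> c; rewrite /pencil_act exchange_big; apply: eq_bigr => r _ /=.
rewrite mxeval_sum mulmx_sumr; apply: eq_bigr => i _.
by rewrite /mxeval /= -scalemxAr.
Qed.

Lemma regularT n (X : 'I_g -> 'M[k]_n) : regular (fun=> True) X.
Proof.
by exists (linear_term X); split=> // d A y yfix c; rewrite linear_term_act.
Qed.

Lemma regular_sub (S S' : term k g -> Prop) n (X : 'I_g -> 'M[k]_n) :
  (forall t, S t -> S' t) -> regular S X -> regular S' X.
Proof. by move=> SS' [t [St tfix]]; exists t; split=> // r c; apply: SS'. Qed.

Definition sum_closed (S : term k g -> Prop) :=
  S Zero /\ forall t u, S t -> S u -> S (Add t u).

Lemma term_sum_closed S (I : finType) (F : I -> term k g) :
  sum_closed S -> (forall i, S (F i)) -> S (term_sum F).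
Proof. by case=> S0 SD SF; rewrite /term_sum; elim/big_ind: _. Qed.

(** If [t] and [u] both reproduce every fixed family, so does their matrix product, whose entries
    are sums of products. *)
Lemma regularM (S1 S2 S : term k g -> Prop) n (X : 'I_g -> 'M[k]_n) :
  sum_closed S -> (forall t u, S1 t -> S2 u -> S (Mul t u)) ->
  regular S1 X -> regular S2 X -> regular S X.
Proof.
move=> Sc SM [t [St tfix]] [u [Su ufix]]; exists (term_mul t u); split=> [r c|d A y yfix c].
  by apply: term_sum_closed => // b; apply: SM.
rewrite term_act_mul {1}(ufix _ _ _ yfix c).
by apply: eq_term_act => b; apply: tfix.
Qed.

Definition ann (L : monic_pencil k g) (t : term k g) := mxeval (pcoef L) t = 0.

Lemma ann_sum_closed L : sum_closed (ann L).
Proof. by split=> // t u; rewrite /ann /mxeval /= => -> ->; rewrite addr0. Qed.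

Lemma regular_ann_notin L n (X : 'I_g -> 'M[k]_n) :
  regular (ann L) X -> ~ free_locus L (existT _ n X).
Proof.
move=> [t [t0 tfix]] /free_locusP[y [[c]]] /[swap] /tfix ->.
by rewrite /term_act big1 ?eqxx // => r _; rewrite t0 mulmx0.
Qed.

(* If [p] is the characteristic polynomial of [N := \sum_i A_i *t X_i], then
   [q := 'X * p / p(1)] satisfies [q(N) = 0], [q(0) = 0] and [q(1) = 1]. *)
Lemma notin_regular_ann L n (X : 'I_g -> 'M[k]_n) :
  ~ free_locus L (existT _ n X) -> regular (ann L) X.
Proof.
move=> XL; set A := pcoef L; set N := \sum_i A i *t X i.
have [v|p [p1 pN]] := @Cayley_Hamilton_iter _ N.
  rewrite (encode_family_surj v); set y := (fun r => _).
  rewrite encode_pencil_act => /encode_family_inj yfix.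
  have y0 : y =1 fun=> 0.
    move=> c; apply/eqP/negPn/negP => yc0; apply: XL.
    by apply/free_locusP; exists y; split=> [|c']; [exists c|rewrite yfix].
  by rewrite (funext y0); apply/rowP => j; rewrite !mxE.
(* The exponent is shifted: [pow j] is the power [j + 1] of the matrix of linear terms, so no
   constant term appears. *)
pose pow j := iter j (fun t => term_mul t (linear_term X)) (linear_term X).
exists (fun r c => Scale p.[1]^-1
  (term_sum (fun j : 'I_(size p) => Scale p`_j (pow j r c)))).
have actE d (B : 'I_g -> 'M[k]_d) y c : term_act B (fun r c => Scale p.[1]^-1
  (term_sum (fun j : 'I_(size p) => Scale p`_j (pow j r c)))) y c
  = p.[1]^-1 *: \sum_(j < size p) p`_j *: term_act B (pow j) y c.
  rewrite /term_act.
  under [in RHS]eq_bigr do rewrite scaler_sumr.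
  rewrite exchange_big scaler_sumr; apply: eq_bigr => r _ /=.
  rewrite {1}/mxeval /= -scalemxAr -/(mxeval _ _) mxeval_sum mulmx_sumr.
  by congr (_ *: _); apply: eq_bigr => j _; rewrite /mxeval /= -scalemxAr.
split=> [r c|d B y yfix c].
  (* A family supported at [r] isolates the single entry [(r, c)]. *)
  apply: mul_rV_eq0 => v; pose y r' : 'rV_(psize L) := if r' == r then v else 0.
  have powE j : encode_family (term_act A (pow j) y)
      = iter j (mulmx^~ N) (encode_family y *m N).
    elim: j => [|j IH] /=; last rewrite -IH.
      by rewrite encode_pencil_act; congr encode_family; apply/funext/linear_term_act.
    rewrite encode_pencil_act; congr encode_family; apply/funext => b.
    by rewrite term_act_mul linear_term_act.
  have act0 : encode_family (fun c => \sum_(j < size p) p`_j *: term_act A (pow j) y c)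
      = encode_family (fun=> 0).
    transitivity (0 : 'rV[k]_(psize L * n)); last by apply/rowP => j; rewrite !mxE.
    rewrite -[RHS](pN (encode_family y *m N)); apply/rowP => l.
    rewrite !mxE !summxE; apply: eq_bigr => j _.
    by rewrite -powE !mxE.
  have := actE _ A y c; rewrite (encode_family_inj act0) scaler0.
  rewrite /term_act (bigD1 r) //= big1 ?addr0 => [|r' /negPf r'r].
    by rewrite {1}/y eqxx.
  by rewrite /y r'r mul0mx.
(* For any [B], each power reproduces a fixed family, so the combination acts on it as
   [q(1) = 1]. *)
have powE j : term_act B (pow j) y =1 y.
  elim: j => [|j IH] b /=; first by rewrite linear_term_act -yfix.
  by rewrite term_act_mul (eq_term_act _ _ IH) linear_term_act -yfix.
rewrite actE; under eq_bigr do rewrite powE.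
rewrite -scaler_suml scalerA -[LHS]scale1r; congr (_ *: _).
have <- : p.[1] = \sum_(j < size p) p`_j.
  by rewrite horner_coef; apply: eq_bigr => j _; rewrite expr1n mulr1.
by rewrite mulVf.
Qed.

End RegularPoints.

(** * Simple pencils *)

Section SimplePencils.
Variables (k : fieldType) (g : nat).
Implicit Types (L V W : monic_pencil k g) (S : term k g -> Prop).

Lemma ann_sub_locus V W : (forall t, ann W t -> ann V t) ->
  (free_locus V `<=` free_locus W)%classic.
Proof.
move=> sub [n X] VX; apply: contrapT => /notin_regular_ann reg.
exact: (regular_ann_notin (regular_sub sub reg)).
Qed.

(** Outside both loci there are witnesses with entries in [ann W1] and in [ann W2]; their product
    has entries in [ann V]. *)
Lemma ann_mul_locus V W1 W2 :
  (forall t u, ann W1 t -> ann W2 u -> ann V (Mul t u)) ->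
  (free_locus V `<=` free_locus W1 `|` free_locus W2)%classic.
Proof.
move=> sub [n X] VX; apply: contrapT => /not_orP[].
move=> /notin_regular_ann reg1 /notin_regular_ann reg2.
exact: (regular_ann_notin (regularM (ann_sum_closed V) sub reg1 reg2)).
Qed.

(** No ring laws are imposed on terms, so an ideal of polynomials is a predicate stable under the
    constructors. *)
Definition term_ideal S :=
  [/\ sum_closed S, forall a t, S t -> S (Scale a t) &
      forall t u, S t -> S (Mul t u) /\ S (Mul u t)].

Lemma ann_ideal L : term_ideal (ann L).
Proof.
split=> [|a t|t u]; rewrite /ann /mxeval /=; first exact: ann_sum_closed.
  by move=> ->; rewrite scaler0.
by move=> ->; split; [exact: mul0mx|exact: mulmx0].
Qed.

(** A matrix of largest rank with row space inside [P] works: a vector of [P] outside it would raise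
    the rank. *)
Lemma subspace_mx d (P : 'rV[k]_d -> Prop) :
  P 0 -> (forall v w, P v -> P w -> P (v + w)) -> (forall a v, P v -> P (a *: v)) ->
  exists U : 'M[k]_d, forall v, P v <-> (v <= U)%MS.
Proof.
move=> P0 PD PZ.
pose Q r := `[< exists2 U : 'M[k]_d, \rank U = r & forall v : 'rV_d, (v <= U)%MS -> P v >].
have Q0 : exists r, Q r.
  exists 0%N; apply/asboolP; exists 0; first exact: mxrank0.
  by move=> v; rewrite submx0 => /eqP ->.
have Qd r : Q r -> (r <= d)%N by move=> /asboolP[U <- _]; exact: rank_leq_row.
case: (ex_maxnP Q0 Qd) => r /asboolP[U <- UP] max; exists U => v.
split=> [Pv|]; last exact: UP; apply/negPn/negP => vU.
suff /max : Q (\rank (U + v)%MS).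
  apply/negP; rewrite -ltnNge; apply: rank_ltmx.
  rewrite ltmxE addsmxSl; apply: contra vU; apply: submx_trans; exact: addsmxSr.
apply/asboolP; exists (U + v)%MS => // w /sub_addsmxP[[a b] /= ->].
apply: PD; first by apply: UP; exact: submxMl.
by rewrite [b]mx11_scalar mul_scalar_mx; apply: PZ.
Qed.

Definition stable L (U : 'M[k]_(psize L)) := forall i, (U *m pcoef L i <= U)%MS.

(** The row vectors form a simple module over the coefficients; the nonzero coefficient excludes the
    zero module and the trivial action. *)
Definition simple_pencil L := (exists i, pcoef L i != 0) /\
  forall U, stable (L := L) U -> U = 0 \/ row_full U.

Lemma stable_subspace L (P : 'rV[k]_(psize L) -> Prop) : simple_pencil L ->
  P 0 -> (forall v w, P v -> P w -> P (v + w)) -> (forall a v, P v -> P (a *: v)) ->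
  (forall v i, P v -> P (v *m pcoef L i)) ->
  (forall v, P v -> v = 0) \/ (forall v, P v).
Proof.
move=> [_ Ls] P0 PD PZ PA; have [U UP] := subspace_mx P0 PD PZ.
case: (Ls U) => [i|U0|Uf].
- apply/row_subP => j; rewrite row_mul; apply/UP/PA/UP; exact: row_sub.
- by left=> v /UP; rewrite U0 submx0 => /eqP.
- by right=> v; apply/UP/submx_full.
Qed.

(* The rank of [1 - t] drops when [t] is replaced by [t + a - t a], that is
   [1 - t] by [(1 - t)(1 - a)], with [a] fixing a vector of the image of [1 - t]. *)
Lemma simple_ideal_unit L S s : simple_pencil L -> term_ideal S ->
  S s -> mxeval (pcoef L) s != 0 -> exists2 t, S t & mxeval (pcoef L) t = 1%:M.
Proof.
move=> Ls [[S0 SD] SZ SM] Ss s0; set ev := mxeval (pcoef L).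
pose Q r := `[< exists2 t, S t & \rank (1%:M - ev t) = r >].
have Q0 : exists r, Q r by exists (\rank (1%:M - ev s)); apply/asboolP; exists s.
case: (ex_minnP Q0) => r /asboolP[t St <-] min; exists t => //.
apply/eqP; rewrite eq_sym -subr_eq0; apply/negPn/negP => t1.
have [v wn0] : exists v : 'rV_(psize L), v *m (1%:M - ev t) != 0.
  by apply: contrapT => H; move/eqP: t1; apply; apply: mul_rV_eq0 => v;
     apply/eqP/negPn/negP => ?; apply: H; exists v.
set w := v *m _ in wn0.
(* The vectors killed by [S] form a stable subspace, which is proper because of [s]. *)
have kill (x : 'rV_(psize L)) : (forall u, S u -> x *m ev u = 0) -> x = 0.
  move: x; case: (@stable_subspace L (fun x => forall u, S u -> x *m ev u = 0)) => //.
  - by move=> u _; rewrite mul0mx.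
  - by move=> x y x0 y0 u Su; rewrite mulmxDl x0 // y0 // addr0.
  - by move=> a x x0 u Su; rewrite -scalemxAl x0 // scaler0.
  - move=> x i x0 u Su; rewrite -mulmxA; apply: (x0 (Mul (Var i) u)).
    exact: (SM u _ Su).2.
  by move=> all0; case/eqP: s0; apply: mul_rV_eq0 => x; apply: all0.
(* The vectors [w *m ev a] form a stable subspace, nonzero by [kill]; being everything, it contains
   [w]. *)
have [a Sa wa] : exists2 a, S a & w = w *m ev a.
  case: (@stable_subspace L (fun x => exists2 a, S a & x = w *m ev a)) => //.
  - by exists Zero => //; rewrite mulmx0.
  - by move=> _ _ [a Sa ->] [b Sb ->]; exists (Add a b); [exact: SD|rewrite -mulmxDr].
  - by move=> c _ [a Sa ->]; exists (Scale c a); [exact: SZ|rewrite scalemxAr].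
  - move=> _ i [a Sa ->]; exists (Mul a (Var i)); first exact: (SM a _ Sa).1.
    by rewrite -mulmxA.
  by move=> w0; case/eqP: wn0; apply: kill => u Su; apply: w0; exists u.
pose t' := Add (Add t a) (Scale (-1) (Mul t a)).
have t'E : 1%:M - ev t' = (1%:M - ev t) *m (1%:M - ev a).
  rewrite mulmxBr mulmx1 mulmxBl mul1mx /ev mxevalD mxevalD mxevalZ mxevalM scaleN1r.
  by rewrite -addrA opprD addrA.
have /min : Q (\rank (1%:M - ev t')).
  by apply/asboolP; exists t' => //; apply: (SD); [exact: SD|apply/SZ/(SM _ _ St).1].
(* The rank lost is the dimension of the image of [1 - t] intersected with the kernel of [1 - a].
   Minimality makes it zero, yet [w] lies there. *)
rewrite t'E -(mxrank_mul_ker (1%:M - ev t) (1%:M - ev a)).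
rewrite -[X in (_ <= X)%N]addn0 leq_add2l.
rewrite leqn0 mxrank_eq0 => /eqP K0.
have : (w <= (1%:M - ev t) :&: kermx (1%:M - ev a))%MS.
  rewrite sub_capmx submxMl; apply/sub_kermxP.
  by rewrite mulmxBr mulmx1 -wa subrr.
by rewrite K0 submx0 (negPf wn0).
Qed.

Lemma simple_unit L : simple_pencil L -> exists t, mxeval (pcoef L) t = 1%:M.
Proof.
move=> Ls; have [[i Ai] _] := Ls.
have [//|//|//|t _ t1] := @simple_ideal_unit L (fun=> True) (Var i) Ls.
by exists t.
Qed.

Lemma simple_nonzero L : simple_pencil L -> exists u : 'rV[k]_(psize L), u != 0.
Proof.
move=> [[i Ai] _]; apply: contrapT => H; move/eqP: Ai; apply; apply: mul_rV_eq0 => v.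
by apply/eqP/negPn/negP => ?; apply: H; exists (v *m pcoef L i).
Qed.

(** A product of polynomials with value 1 on [V], one from each [ann (W j)], lies in all these
    ideals; [term_point] turns it into a point. *)
Lemma simple_separated V (I : eqType) (W : I -> monic_pencil k g) (s : seq I) :
  simple_pencil V -> (forall j, j \in s -> ~ (forall t, ann (W j) t -> ann V t)) ->
  exists2 X, free_locus V X & forall j, j \in s -> ~ free_locus (W j) X.
Proof.
move=> Vs sep.
suff [t t1 tW] : exists2 t, mxeval (pcoef V) t = 1%:M &
    forall j, j \in s -> ann (W j) t.
  have [X XE] := term_point t; exists X.
    by apply/XE; have [u u0] := simple_nonzero Vs; exists u; rewrite // t1 mulmx1.
  move=> j js /XE[u /[swap]]; rewrite (tW j js) mulmx0 => ->.
  by rewrite eqxx.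
elim: s sep => [|j s IH] sep; first by have [t t1] := simple_unit Vs; exists t.
have [|t t1 tW] := IH; first by move=> j' j's; apply: sep; rewrite inE j's orbT.
have /existsNP[u /not_implyP[uW uV]] := sep j (mem_head _ _).
have [|a aW a1] := simple_ideal_unit Vs (ann_ideal (W j)) uW; first exact/eqP.
exists (Mul t a); first by rewrite mxevalM t1 a1 mulmx1.
move=> j'; rewrite inE => /predU1P[->|j's].
  by case: (ann_ideal (W j)) => _ _ /(_ _ t aW)[].
by case: (ann_ideal (W j')) => _ _ /(_ _ a (tW _ j's))[].
Qed.

(** [W] is the action on [U] and [V] the action on the quotient. If [t] is zero on the quotient, it
    maps into [U], where [u] is zero. *)
Lemma stable_split L (U : 'M[k]_(psize L)) : stable U -> U != 0 -> ~~ row_full U ->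
  exists V W : monic_pencil k g,
    [/\ (psize V < psize L)%N, (psize W < psize L)%N, forall t, ann L t -> ann V t,
        forall t, ann L t -> ann W t &
        forall t u, ann V t -> ann W u -> ann L (Mul t u)].
Proof.
(* [B] is a basis of [U], [K] the projection to the quotient, and [G] a section of [K]. *)
move=> Ust U0 Uf; set A := pcoef L; set B := row_base U; set K := col_base (cokermx U).
pose G := pinvmx K.
have GK : G *m K = 1%:M by apply: mulVpmx; exact: col_base_full.
have kerK m (v : 'M_(m, _)) : v *m K = 0 <-> (v <= B)%MS.
  rewrite eq_row_base submxE; split=> [vK|/eqP vK].
    by rewrite -(mulmx_base (cokermx U)) mulmxA vK mul0mx.
  by apply: (row_free_inj (row_base_free (cokermx U))); rewrite -mulmxA mulmx_base mul0mx.
clearbody G K.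
have AK i : A i *m K = K *m (G *m A i *m K).
  apply/eqP; rewrite -subr_eq0; apply/eqP.
  rewrite !mulmxA -mulmxBl; apply/kerK; rewrite eq_row_base.
  rewrite -[X in X - _]mul1mx -mulmxBl; apply: submx_trans (Ust i); apply: submxMr.
  suff: (1%:M - K *m G <= B)%MS by rewrite eq_row_base.
  by apply/kerK; rewrite mulmxBl mul1mx -mulmxA GK mulmx1 subrr.
have AB i : B *m A i = (B *m A i *m pinvmx B) *m B.
  rewrite mulmxKpV // eq_row_base; apply: submx_trans (Ust i); apply: submxMr.
  by rewrite eq_row_base.
pose W := MonicPencil (fun i => B *m A i *m pinvmx B).
pose V := MonicPencil (fun i => G *m A i *m K).
have evW t : B *m mxeval A t = mxeval (pcoef W) t *m B.
  rewrite /mxeval; elim: t => [i||t IHt u IHu|t IHt u IHu|a t IHt] /=.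
  - exact: AB.
  - by rewrite mulmx0 mul0mx.
  - by rewrite mulmxDr mulmxDl IHt IHu.
  - by rewrite mulmxA IHt -mulmxA IHu mulmxA.
  - by rewrite -scalemxAr -scalemxAl IHt.
have evV t : mxeval A t *m K = K *m mxeval (pcoef V) t.
  rewrite /mxeval; elim: t => [i||t IHt u IHu|t IHt u IHu|a t IHt] /=.
  - exact: AK.
  - by rewrite mulmx0 mul0mx.
  - by rewrite mulmxDr mulmxDl IHt IHu.
  - by rewrite -mulmxA IHu mulmxA IHt mulmxA.
  - by rewrite -scalemxAr -scalemxAl IHt.
exists V, W; split=> [||t Lt|t Lt|t u Vt Wu].
- rewrite /= mxrank_coker ltn_subrL lt0n mxrank_eq0 U0.
  by rewrite (leq_trans _ (rank_leq_row U)) // lt0n mxrank_eq0.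
- by rewrite /= ltn_neqAle rank_leq_col andbT.
- by rewrite /ann -[LHS]mul1mx -GK -mulmxA -evV Lt mul0mx mulmx0.
- by apply: (row_free_inj (row_base_free U)); rewrite -evW Lt mulmx0 mul0mx.
have /submxP[D tD] : (mxeval A t <= B)%MS by apply/kerK; rewrite evV Vt mulmx0.
by rewrite /ann mxevalM tD -mulmxA evW Wu mul0mx mulmx0.
Qed.

End SimplePencils.

(** * Irreducible loci *)

Section IrreducibleLoci.
Variables (k : fieldType) (g : nat).
Implicit Types (L V W : monic_pencil k g) (Z : set (matrix_tuple k g)).
Local Open Scope classical_set_scope.

(** Otherwise a single point of [free_locus V] would avoid the finitely many loci of the cover. *)
Lemma simple_covered V m (W : 'I_m -> monic_pencil k g) (J : set 'I_m) :
  simple_pencil V -> free_locus V `<=` \bigcup_(j in J) free_locus (W j) ->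
  exists2 j, J j & forall t, ann (W j) t -> ann V t.
Proof.
move=> Vs cover; apply: contrapT => none.
have [|X VX out] := @simple_separated _ _ _ _ W [seq j <- enum 'I_m | `[< J j >]] Vs.
  by move=> j; rewrite mem_filter => /andP[/asboolP Jj _] sub; apply: none; exists j.
have [j Jj WX] := cover X VX; apply: (out j) => //.
by rewrite mem_filter mem_enum andbT; apply/asboolP.
Qed.

Lemma simple_irreducible V : simple_pencil V -> irreducible_locus (free_locus V).
Proof.
move=> Vs; split; first by exists V.
  by have [//|X VX _] := @simple_separated k g V bool (fun=> V) [::] Vs; exists X.
move=> [_ [_ [[W1 ->] [W2 ->] [V1 n1] [V2 n2] VE]]].
have [X|j _ sub] := @simple_covered V 2 (fun j => if j == ord0 then W1 else W2) setT Vs.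
  by rewrite {1}VE => -[?|?]; [exists ord0|exists ord_max].
have := ann_sub_locus sub; case: ifP => _ ?; [exact: n1|exact: n2].
Qed.

Lemma locus_nonzero L : free_locus L !=set0 -> exists i, pcoef L i != 0.
Proof.
move=> [[n X] /free_locusP[y [[c yc0] yfix]]]; apply: contrapT => H.
case/eqP: yc0; rewrite yfix /pencil_act big1 // => i _; rewrite big1 // => r _.
have -> : pcoef L i = 0 by apply/eqP/negPn/negP => ?; apply: H; exists i.
by rewrite mulmx0 scaler0.
Qed.

Lemma irreducible_locus_simple Z : irreducible_locus Z ->
  exists L, [/\ minimal_pencil L, simple_pencil L & Z = free_locus L].
Proof.
move=> [[L0 ->] ne irr]; set Z0 := free_locus L0 in ne irr *.
pose Q n := `[< exists2 L, psize L = n & free_locus L = Z0 >].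
have Q0 : exists n, Q n by exists (psize L0); apply/asboolP; exists L0.
case: (ex_minnP Q0) => n /asboolP[L <- LZ] min.
exists L; split=> [L' L'L|//|//].
  by apply: min; apply/asboolP; exists L'; rewrite // L'L.
split=> [|U Ust]; first by apply: locus_nonzero; rewrite LZ.
apply: contrapT => /not_orP[/eqP U0 /negP Uf].
have [V [W [Vlt Wlt LV LW VW]]] := stable_split Ust U0 Uf.
have sub V' : (psize V' < psize L)%N -> (forall t, ann L t -> ann V' t) ->
    free_locus V' `<` Z0.
  move=> lt ann'; have le := ann_sub_locus ann'; rewrite -LZ; split=> // le'.
  move: lt; rewrite ltnNge => /negP; apply; apply: min; apply/asboolP.
  by exists V'; rewrite // -LZ; apply/seteqP.
apply: irr; exists (free_locus V), (free_locus W).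
split; [by exists V|by exists W|exact: sub|exact: sub|].
have [VZ WZ] := (sub V Vlt LV, sub W Wlt LW).
apply/seteqP; split; first by rewrite -LZ; exact: ann_mul_locus.
by move=> X [/VZ.1|/WZ.1].
Qed.

Lemma irreducible_covered Z m (C : 'I_m -> set (matrix_tuple k g)) (J : set 'I_m) :
  irreducible_locus Z -> (forall j, irreducible_locus (C j)) ->
  Z `<=` \bigcup_(j in J) C j -> exists2 j, J j & Z `<=` C j.
Proof.
move=> /irreducible_locus_simple[V [_ Vs ->]] Cirr cover.
have /choice[W CW] : forall j, exists W, C j = free_locus W by move=> j; case: (Cirr j).
have [|j Jj sub] := @simple_covered V m W J Vs.
  by move=> X /cover[j Jj]; rewrite CW; exists j.
by exists j => //; rewrite CW; exact: ann_sub_locus.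
Qed.

(** Each [D j] lies in some [C i], and that in some [D j']; irredundancy forces [j' = j], hence
    [D j = C i]. *)
Lemma irredundant_range Z s t (C : 'I_s -> set (matrix_tuple k g))
    (D : 'I_t -> set (matrix_tuple k g)) :
  irredundant_decomposition Z C -> irredundant_decomposition Z D ->
  range D `<=` range C.
Proof.
move=> [Cirr ZC _] [Dirr ZD Dmin] _ [j _ <-].
have [|i _ DC] := @irreducible_covered (D j) s C setT (Dirr j) Cirr.
  by rewrite -ZC ZD => X DX; exists j.
have [|j' _ CD] := @irreducible_covered (C i) t D setT (Cirr i) Dirr.
  by rewrite -ZD ZC => X CX; exists i.
exists i => //; apply/seteqP; split=> //.
have [<-//|/eqP j'j] := pselect (j' = j); exfalso; apply: (Dmin j).
rewrite ZD; apply/seteqP; split=> X [l lj DX]; last by exists l.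
have [lE|/eqP] := pselect (l = j); last by exists l.
by exists j' => //; apply/CD/DC; rewrite -lE.
Qed.

End IrreducibleLoci.

(** * Coefficient algebras and their simple quotients *)

Section CoefficientAlgebra.
Variables (k : fieldType) (g : nat).
Implicit Types (L V : monic_pencil k g).
Local Open Scope classical_set_scope.

Lemma pcoef_generated L i :
  pcoef L i \in subalgebra_pred (generated (range (pcoef L))).
Proof. by apply/asboolP => S [_]; apply; exists i. Qed.

Definition generator L i : coefficient_algebra L :=
  SubalgebraElt (pcoef_generated L i).

Lemma val_teval L t : val (teval (@generator L) t) = mxeval (pcoef L) t.
Proof.
elim: t => [i||t IHt u IHu|t IHt u IHu|a t IHt] //.
- by rewrite mxevalD -IHt -IHu; exact: subalgebra_valD.
- by rewrite mxevalM -IHt -IHu.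
- by rewrite mxevalZ -IHt; exact: subalgebra_valZ.
Qed.

Lemma generator_surj L (z : coefficient_algebra L) :
  exists t, teval (@generator L) t = z.
Proof.
suff [t tz] : exists t, mxeval (pcoef L) t = val z.
  by exists t; apply: val_inj; rewrite val_teval.
have /asboolP := subalgebra_valP z.
apply: (_ : smallest _ _ `<=` (fun M => exists t, mxeval (pcoef L) t = M)).
apply: smallest_sub; last by move=> _ [i _ <-]; exists (Var i).
split; first split.
- by exists Zero.
- by move=> _ _ [t <-] [u <-]; exists (Add t u).
- by move=> a _ [t <-]; exists (Scale a t).
- by move=> _ _ [t <-] [u <-]; exists (Mul t u).
Qed.

(** A nonzero ideal contains the identity matrix, by [simple_ideal_unit] for the polynomials with
    value in it. *)
Lemma simple_coefficient_algebra L :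
  simple_pencil L -> simple_algebra (coefficient_algebra L).
Proof.
move=> Ls; split.
  have [t t1] := simple_unit Ls; have [u /eqP u0] := simple_nonzero Ls.
  exists (teval (@generator L) t), (teval (@generator L) t) => /(congr1 val).
  rewrite -[_ ** _]/(teval (@generator L) (Mul t t)) val_teval mxevalM t1 mulmx1.
  by move=> one0; apply: u0; rewrite -[u]mulmx1 [1%:M]one0 mulmx0.
move=> I; have [[I0 ID IZ] IM] := idealP I.
have [[z Iz z0]|nz] := pselect (exists2 z, ideal_set I z & z <> 0); [right|left].
  have [s sz] := generator_surj z.
  have [|||t It t1] := @simple_ideal_unit _ _ L
    (fun t => ideal_set I (teval (@generator L) t)) s Ls.
  - split=> [|a t It|t u It]; [split=> // t u; exact: ID|exact: IZ|].
    by have [] := IM (teval (@generator L) u) _ It.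
  - by rewrite sz.
  - by rewrite -val_teval sz; apply/eqP => z0'; apply: z0; exact: val_inj.
  apply/seteqP; split=> // x _; have [u <-] := generator_surj x.
  suff -> : teval (@generator L) u = teval (@generator L) (Mul u t).
    exact: (IM _ _ It).1.
  by apply: val_inj; rewrite !val_teval mxevalM t1 mulmx1.
apply/seteqP; split=> [x Ix|x ->//]; apply: contrapT => x0; apply: nz; by exists x.
Qed.

(** * Simple quotients realized by pencils *)

Lemma zero_coef_ann L t : (forall i, pcoef L i = 0) -> ann L t.
Proof.
move=> L0; rewrite /ann; elim: t => [i||t IHt u IHu|t IHt u IHu|a t IHt] //.
- exact: L0.
- by rewrite mxevalD IHt IHu addr0.
- by rewrite mxevalM IHt mul0mx.
- by rewrite mxevalZ IHt scaler0.
Qed.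

Lemma nmul0r (B : nalgType k) (x : B) : 0 ** x = 0.
Proof. by rewrite -[X in X ** _](scale0r 0) nmulZl scale0r. Qed.

Lemma nmulr0 (B : nalgType k) (x : B) : x ** 0 = 0.
Proof. by rewrite -[X in _ ** X](scale0r 0) nmulZr scale0r. Qed.

Lemma simple_quotient_image (B : nalgType k) (b : 'I_g -> B) (S : term k g -> Prop) :
  simple_algebra B -> (forall z, exists t, teval b t = z) -> term_ideal S ->
  (forall t, S t -> teval b t = 0) \/ (forall z, exists2 t, S t & teval b t = z).
Proof.
move=> [_ Bs] surj [[S0 SD] SZ SM].
have Iid : is_ideal (fun z => exists2 t, S t & teval b t = z).
  split; first split.
  - by exists Zero.
  - by move=> _ _ [t St <-] [u Su <-]; exists (Add t u) => //; exact: SD.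
  - by move=> a _ [t St <-]; exists (Scale a t) => //; exact: SZ.
  move=> x _ [t St <-]; have [u <-] := surj x; have [tu ut] := SM t u St.
  by split; [exists (Mul u t)|exists (Mul t u)].
case: (Bs (Ideal Iid)) => /= IE; [left|right].
  move=> t St; have : [set (0 : B)] (teval b t) by rewrite -IE; exists t.
  by [].
by move=> z; have : [set: B] z by []; rewrite -IE.
Qed.

Lemma simple_quotient_pencil L (B : nalgType k) (b : 'I_g -> B) :
  simple_algebra B -> (forall z, exists t, teval b t = z) ->
  (forall t, ann L t -> teval b t = 0) ->
  exists2 V, simple_pencil V & forall t, ann V t <-> teval b t = 0.
Proof.
move=> Bs surj L0; have [[x [y xy]] _] := Bs.
pose Q n := `[< exists2 V, psize V = n & forall t, ann V t -> teval b t = 0 >].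
have Q0 : exists n, Q n by exists (psize L); apply/asboolP; exists L.
case: (ex_minnP Q0) => n /asboolP[V <- V0] min.
(* By minimality [ann V'] is not sent to zero in [B], and its image is an ideal of a simple
   algebra. *)
have big V' : (psize V' < psize V)%N -> forall z, exists2 t, ann V' t & teval b t = z.
  move=> lt; case: (simple_quotient_image Bs surj (ann_ideal V')) => // V'0.
  have : Q (psize V') by apply/asboolP; exists V'.
  by move/min; rewrite leqNgt lt.
have Vs : simple_pencil V.
  split=> [|U Ust].
    apply: contrapT => nz; have [t tx] := surj x; apply: xy.
    rewrite -tx V0 ?nmul0r //; apply: zero_coef_ann => i.
    by apply/eqP/negPn/negP => ?; apply: nz; exists i.
  apply: contrapT => /not_orP[/eqP U0 /negP Uf].
  have [V1 [V2 [lt1 lt2 _ _ V12]]] := stable_split Ust U0 Uf.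
  (* Representatives of [x] and [y] taken in the two smaller annihilators have a product vanishing
     on [V], hence in [B]. *)
  have [[t V1t tx] [u V2u uy]] := (big V1 lt1 x, big V2 lt2 y).
  by apply: xy; rewrite -tx -uy; apply: (V0 (Mul t u)); apply: V12.
exists V => // s; split=> [|s0]; first exact: V0.
apply: contrapT => /eqP sV.
(* Some [t] is then 0 in [B] and 1 on [V]. For [u] representing [x], [u - u t] vanishes on [V],
   hence in [B], so [x = 0]. *)
have [|//|//|t t0 t1] := @simple_ideal_unit _ _ V (fun t => teval b t = 0) s Vs.
  split=> [|a t /= ->|t u /= ->]; [split=> //= t u -> ->|by rewrite scaler0|by rewrite nmul0r nmulr0].
  by rewrite addr0.
have [u ux] := surj x; apply: xy; rewrite -ux.
have : teval b (Add u (Scale (-1) (Mul u t))) = 0.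
  by apply: V0; rewrite /ann mxevalD mxevalZ mxevalM t1 mulmx1 scaleN1r subrr.
by rewrite /= t0 nmulr0 scaler0 addr0 => ->; rewrite nmul0r.
Qed.

(** * Nilpotent ideals and the decomposition into components *)

Lemma foldl_nmulD (B : nalgType k) (x y : B) s :
  foldl nmul (x + y) s = foldl nmul x s + foldl nmul y s.
Proof. by elim: s x y => //= z s IH x y; rewrite nmulDl IH. Qed.

Lemma foldl_nmul0 (B : nalgType k) (s : seq B) : foldl nmul 0 s = 0.
Proof. by elim: s => //= z s IH; rewrite nmul0r. Qed.

Lemma nilpotent_regular L (I : ideal (coefficient_algebra L)) n (X : 'I_g -> 'M[k]_n) :
  nilpotent_ideal I -> regular (fun t => ideal_set I (teval (@generator L) t)) X ->
  regular (ann L) X.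
Proof.
move=> [m Im] reg; set S := (fun t => _) in reg.
(* [Sp p] contains the products of [p + 1] elements of [I]: they die after [m - p] further factors.
   At [p = m] no factor is left. *)
pose Sp p t := forall s : seq (coefficient_algebra L),
  (forall y, y \in s -> ideal_set I y) -> size s = (m - p)%N ->
  foldl nmul (teval (@generator L) t) s = 0.
suff /(_ m (leqnn m)) : forall p, (p <= m)%N -> regular (Sp p) X.
  apply: regular_sub => t /(_ [::]) /= t0; rewrite /ann -val_teval t0 ?subnn //.
elim=> [|p IH] pm.
  by apply: regular_sub reg => t It s Is; rewrite subn0; apply: Im.
apply: regularM (IH (ltnW pm)) reg.
  split=> [s _ _|t u St Su s Is sz /=]; first exact: foldl_nmul0.
  by rewrite foldl_nmulD St // Su // addr0.
move=> t u St Su s Is sz; apply: (St (teval (@generator L) u :: s)).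
  by move=> y; rewrite inE => /predU1P[->//|]; apply: Is.
by rewrite /= sz -subSn.
Qed.

(** The product of the witnesses for the separate [V i] has its entries in every [ann (V i)], as
    these are ideals. *)
Lemma regular_all_ann s (V : 'I_s -> monic_pencil k g) n (X : 'I_g -> 'M[k]_n) :
  (forall i, ~ free_locus (V i) (existT _ n X)) ->
  regular (fun t => forall i, ann (V i) t) X.
Proof.
move=> out; suff : forall r : seq 'I_s,
    regular (fun t => forall i, i \in r -> ann (V i) t) X.
  by move/(_ (enum 'I_s)); apply: regular_sub => t tr i; apply: tr; rewrite mem_enum.
elim=> [|j r IH]; first by apply: regular_sub (regularT X).
apply: regularM IH (notin_regular_ann (out j)).
  split=> [//|t u tr ur i ir].
  by apply: (ann_sum_closed _).2; [exact: tr|exact: ur].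
move=> t u tr uj i; rewrite inE => /predU1P[->|ir].
  by case: (ann_ideal (V j)) => _ _ /(_ _ t uj)[].
by case: (ann_ideal (V i)) => _ _ /(_ _ u (tr i ir))[].
Qed.

Lemma radical_quotient_components L (radA : ideal (coefficient_algebra L)) s :
  nilpotent_ideal radA -> product_of_simples (quotient_algebra radA) s ->
  has_exactly_components (free_locus L) s.
Proof.
move=> nil [B [Bs [f [fbij fM]]]].
(* [q] evaluates a polynomial in the product of simple algebras; [b i] gives the images of the
   generators in the factor [B i]. *)
pose q t : product_algebra B := f (quotient_pi radA (teval (@generator L) t)).
pose b i j : B i := q (Var j) i.
have qb t i : q t i = teval (b i) t.
  elim: t => [j||t IHt u IHu|t IHt u IHu|a t IHt] //=.
  - have -> : q Zero = 0 by rewrite /q /= [quotient_pi _ _](raddf0 _) raddf0.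
    by rewrite ffunE.
  - by rewrite -IHt -IHu /q /= quotient_piD raddfD ffunE.
  - by rewrite -IHt -IHu /q /= quotient_piM fM ffunE.
  - by rewrite -IHt /q /= quotient_piZ linearZ ffunE.
have qsurj (p : product_algebra B) : exists t, forall i, teval (b i) t = p i.
  have [h fh hf] := fbij; have [t tE] := generator_surj (quotient_repr (h p)).
  by exists t => i; rewrite -qb /q tE quotient_reprK hf.
have bsurj i z : exists t, teval (b i) t = z.
  have [t tE] := qsurj ([ffun l => dfwith (fun l => 0 : B l) z l] : product_algebra B).
  by exists t; rewrite tE ffunE dfwith_in.
have annb t i : ann L t -> teval (b i) t = 0.
  move=> t0; rewrite -qb; have -> : q t = q Zero; last by rewrite qb.
  by congr (f (quotient_pi _ _)); apply: val_inj; rewrite val_teval t0.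
have /choice[V VP] : forall i,
    exists V, simple_pencil V /\ forall t, ann V t <-> teval (b i) t = 0.
  move=> i; have [V ? ?] := simple_quotient_pencil (Bs i) (bsurj i) (fun t => annb t i).
  by exists V.
have Vs i := (VP i).1; have VE i := (VP i).2.
have ZE : free_locus L = \bigcup_i free_locus (V i).
  apply/seteqP; split=> [[n X] LX|X [i _]]; last first.
    by apply: ann_sub_locus => t /(annb _ i) /VE.
  apply: contrapT => out.
  have /regular_all_ann : forall i, ~ free_locus (V i) (existT _ n X).
    by move=> i VX; apply: out; exists i.
  (* Polynomials vanishing on all [V i] are zero in the product, so their values lie in the
     nilpotent ideal [radA]. *)
  move=> reg; apply: regular_ann_notin LX; apply: nilpotent_regular nil _.
  apply: regular_sub reg => t t0; apply/asboolP.
  rewrite -[_ t]subr0; apply/quotient_piE; apply: (bij_inj fbij).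
  by apply/ffunP => i; rewrite [LHS]qb (VE i t).1 // [RHS](qb Zero).
have incomparable i j : (forall t, ann (V j) t -> ann (V i) t) -> j = i.
  move=> sub; apply: contrapT => /eqP ji.
  have [[x [y xy]] _] := Bs i.
  (* An element equal to [x] in the factor [i] and to 0 elsewhere is killed by [V j], but not by
     [V i]. *)
  have [t tE] := qsurj ([ffun l => dfwith (fun l => 0 : B l) x l] : product_algebra B).
  have /sub/VE : ann (V j) t by apply/VE; rewrite tE ffunE dfwith_out // eq_sym.
  by rewrite tE ffunE dfwith_in => x0; apply: xy; rewrite x0 nmul0r.
exists (fun i => free_locus (V i)); suff H :
    irredundant_decomposition (free_locus L) (fun i => free_locus (V i)).
  split=> // t D HD; apply/seteqP.
  by split; [exact: irredundant_range H HD|exact: irredundant_range HD H].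
split=> [i|//|i ZEi]; first exact: simple_irreducible.
have [|j /= ji /incomparable jE] := @simple_covered _ _ (V i) s V [set j | j != i] (Vs i).
  by rewrite -ZEi ZE => X VX; exists i.
by move: ji; rewrite jE eqxx.
Qed.

End CoefficientAlgebra.

Theorem proposition3p12 (k : fieldType) (g : nat) (hk : [pchar k] =i pred0) :
  (forall (L : monic_pencil k g) (radA : ideal (coefficient_algebra L)) (s : nat),
      largest_nilpotent_ideal radA ->
      product_of_simples (quotient_algebra radA) s ->
      has_exactly_components (free_locus L) s)
  /\
  (forall Z : set (matrix_tuple k g),
      irreducible_locus Z ->
      exists L : monic_pencil k g, irreducible_pencil L /\ Z = free_locus L).
Proof.
split=> [L radA s [nil _]|Z /irreducible_locus_simple[L [Lmin Ls ZL]]].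
  exact: radical_quotient_components.
by exists L; split=> //; split=> //; exact: simple_coefficient_algebra.
Qed.
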